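(* For each integer $r\ge 2$, there exists a constant $C_r>0$ such that for any $0<\varepsilon\le 1/2$, every graph $G$ that contains no complete subgraph on $r+1$ vertices ($K_{r+1}$-free) admits a partition of $V(G)$ into at most $(1/\varepsilon)^{C_r}$ sets, each of which is $\varepsilon$-sparse.
   Context: All graphs are finite and simple. For $\varepsilon>0$ and a graph $G$, a set $S\subseteq V(G)$ is $\varepsilon$-sparse if the induced subgraph $G[S]$ has maximum degree at most $\varepsilon|S|$. Since $K_{r+1}$ is complete, containing it as a subgraph is the same as containing it as an induced subgraph. *)

(* Defs.v *)
From mathcomp Require Import all_boot all_order all_algebra.
From mathcomp Require Import all_classical all_reals all_analysis.

Set Implicit Arguments.
Unset Strict Implicit.
Unset Printing Implicit Defensive.

Import Order.TTheory GRing.Theory Num.Theory.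
Local Open Scope ring_scope.

(* A finite simple graph is given by its vertex type [V : finType] and a
   symmetric irreflexive adjacency relation [e : rel V]. *)

Definition is_clique (V : finType) (e : rel V) (K : {set V}) : Prop :=
  {in K &, forall x y, x != y -> e x y}.

Definition complete_free (V : finType) (e : rel V) (k : nat) : Prop :=
  ~ exists K : {set V}, #|K| = k /\ is_clique e K.

Definition induced_degree (V : finType) (e : rel V) (S : {set V}) (x : V) : nat :=
  #|[set y in S | e x y]|.

(* The maximum degree of G[S]; it is 0 when S is empty. *)
Definition induced_max_degree (V : finType) (e : rel V) (S : {set V}) : nat :=
  (\max_(x in S) induced_degree e S x)%N.

Definition sparse (R : realType) (eps : R) (V : finType) (e : rel V)
    (S : {set V}) : Prop :=
  (induced_max_degree e S)%:R <= eps * #|S|%:R.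

(* Main.v *)
Require Import Defs.
From mathcomp Require Import all_boot zify.
From mathcomp Require boolp.

(**
Fix an integer m >= 1/eps and maintain sparse sets X_1, ..., X_j together with
a remainder W that is tiny compared with every X_i.  The X_i are regular: any
choice of subsets A_i of relative density 1/poly(m) spans many transversal
j-cliques.  A vertex of W with few neighbours in some X_i can be added to X_i
(or to a large part of X_i) without destroying sparseness.  The other vertices
of W see many neighbours in every X_i, so that (W, X_1, ..., X_j) has clique
density at least 1/poly(m), and for j = r there are none of them because G is
K_{r+1}-free.

A density increment yields subsets X'_0 of W and X'_i of X_i that are again
regular.  They only have relative size exp(-poly(m)), but this is affordable:
since every K_{r+1}-free graph has a sparse set of relative size m^-r, peeling
off poly(m) sparse sets makes the remainder tiny even compared with the X'_i.
After r rounds everything is absorbed.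
*)

Set Implicit Arguments.
Unset Strict Implicit.
Unset Printing Implicit Defensive.

Section TransversalCliques.

Variables (V : finType) (e : rel V).
Implicit Types (x y w : V) (A B S U W X Y Z : {set V}) (a b s t : seq {set V}).

(** * Counting transversal cliques, and boxes of dense subsets *)

Definition nbhd x : {set V} := [set y | e x y].

Definition traces x s := [seq X :&: nbhd x | X <- s].

(** Once [x] is chosen in the head, later choices are confined to its neighbourhood. Recursion on
    [traces x t] is not structural, hence the fuel. *)
Fixpoint ncliques_rec n s : nat :=
  if s is X :: t then
    if n is n'.+1 then \sum_(x in X) ncliques_rec n' (traces x t) else 0
  else 1.

(* The number of cliques with one vertex in each term of [s]; the fuel of
   [ncliques_rec] is exactly the length of [s]. *)
Definition ncliques s := ncliques_rec (size s) s.

Definition volume s := \prod_(X <- s) #|X|.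

(* [box k a s]: every term of [a] is a subset of the corresponding term of
   [s], of relative density at least [1 / k]. *)
Definition box k a s :=
  all2 (fun A X => (A \subset X) && (#|X| <= k * #|A|)) a s.

Lemma ncliques_cons X s :
  ncliques (X :: s) = \sum_(x in X) ncliques (traces x s).
Proof. by apply: eq_bigr => x _; rewrite /ncliques size_map. Qed.

Lemma volume_cons X s : volume (X :: s) = #|X| * volume s.
Proof. exact: big_cons. Qed.

Lemma volume_cat s t : volume (s ++ t) = volume s * volume t.
Proof. exact: big_cat. Qed.

Lemma volume_traces x s : volume (traces x s) <= volume s.
Proof.
elim: s => [|X s IH] //; rewrite /traces map_cons -/(traces x s) !volume_cons.
by rewrite leq_mul // subset_leq_card // subsetIl.
Qed.

Lemma ncliques_le_volume s : ncliques s <= volume s.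
Proof.
elim: {s}(size s) {-2}s (erefl (size s)) => [|n IH] [|X s] //= => [_|[sz]].
  by rewrite /volume big_nil.
rewrite ncliques_cons volume_cons -sum_nat_const leq_sum // => x _.
by apply: leq_trans (volume_traces x s); apply: IH; rewrite size_map.
Qed.

(** A transversal clique meets the split term either in [A] or outside it, and intersecting with a
    neighbourhood respects this split. *)
Lemma ncliques_split s X A t : A \subset X ->
  ncliques (s ++ X :: t) =
    ncliques (s ++ A :: t) + ncliques (s ++ (X :\: A) :: t).
Proof.
elim: {s}(size s) {-2}s (erefl (size s)) X A t => [|n IH] [|Y s] //= => [_|[sz]] X A t AX.
  rewrite !ncliques_cons (big_setID A) /= (setIidPr AX); congr (_ + _).
rewrite !ncliques_cons -big_split; apply: eq_bigr => x _ /=.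
rewrite /traces !map_cat !map_cons -!/(traces x _).
rewrite (IH (traces x s) _ _ (A :&: nbhd x)) ?size_map ?setSI //.
congr (_ + ncliques (_ ++ _ :: _)); apply/setP => y; rewrite !inE.
by case: (y \in A); case: (y \in X); case: (e x y).
Qed.

(** Add the chosen vertex [x] of the head to a clique in the traces. The last clause carries the
    induction: it puts that clique inside the neighbourhood of [x]. *)
Lemma ncliques_gt0_clique s : symmetric e -> irreflexive e -> 0 < ncliques s ->
  exists2 K : {set V}, #|K| = size s & {in K &, forall x y, x != y -> e x y}
     /\ forall x, x \in K -> has (fun X => x \in X) s.
Proof.
move=> esym eirr.
elim: {s}(size s) {-2}s (erefl (size s)) => [|n IH] [|X s] //= => [_ _|[sz]].
  by exists set0; [rewrite cards0 | split=> x; rewrite inE].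
rewrite ncliques_cons lt0n sum_nat_eq0 => /forall_inPn [x xX].
rewrite -lt0n => /IH []; first by rewrite size_map.
move=> K cK [Kc Ks].
have Kx y : y \in K -> e x y && has (fun Y => y \in Y) s.
  move=> /Ks /hasP [_ /mapP [Y Ys ->]]; rewrite !inE => /andP [yY exy].
  by rewrite exy; apply/hasP; exists Y.
have xK : x \notin K by apply/negP => /Kx; rewrite eirr.
exists (x |: K); first by rewrite cardsU1 xK cK size_map.
split=> [y z|y]; rewrite !inE.
  move=> /predU1P [->|yK] /predU1P [->|zK]; rewrite ?eqxx // => nyz.
  - by case/andP: (Kx _ zK).
  - by rewrite esym; case/andP: (Kx _ yK).
  - exact: Kc.
by move=> /predU1P [->|/Kx /andP [_ ->]]; rewrite ?xX ?orbT.
Qed.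

Lemma box_refl k s : 0 < k -> box k s s.
Proof. by move=> k0; elim: s => //= X s ->; rewrite subxx leq_pmull. Qed.

Lemma box_size k a s : box k a s -> size a = size s.
Proof. by elim: s a => [|X s IH] [|A a] //= /andP [_ /IH ->]. Qed.

Lemma box_le k l a s : k <= l -> box k a s -> box l a s.
Proof.
move=> kl; elim: s a => [|X s IH] [|A a] //= /andP [/andP [-> h] /IH ->].
by rewrite andbT (leq_trans h) // leq_mul2r kl orbT.
Qed.

Lemma box_trans k l a b s : box k a b -> box l b s -> box (k * l) a s.
Proof.
elim: s a b => [|X s IH] [|A a] [|B b] //=.
move=> /andP [/andP [AB hB] hab] /andP [/andP [BX hX] hbs].
rewrite (subset_trans AB BX) (IH _ _ hab hbs) andbT /=.
by rewrite (leq_trans hX) // mulnAC mulnC leq_mul2r hB orbT.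
Qed.

Lemma box_cat k a b s t : box k a s -> box k b t -> box k (a ++ b) (s ++ t).
Proof. by elim: s a => [|X s IH] [|A a] //= /andP [-> /IH h] /h ->. Qed.

Lemma volume_box k a s : box k a s -> volume s <= k ^ size s * volume a.
Proof.
elim: s a => [|X s IH] [|A a] //= => [_|/andP [/andP [_ hX] /IH h]].
  by rewrite mul1n.
by rewrite !volume_cons expnS mulnACA leq_mul.
Qed.

Lemma volume_box_le k a s : box k a s -> volume a <= volume s.
Proof.
elim: s a => [|X s IH] [|A a] //= => /andP [/andP [hX _] /IH h].
by rewrite !volume_cons leq_mul // subset_leq_card.
Qed.

(** * Density increments and regular sub-boxes *)

(* No sub-box of relative density [1 / H] has clique density larger than that
   of [s] by a factor more than [1 + 1 / Delta]. *)
Definition increment_free Delta H s := forall a, box H a s ->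
  ncliques a * volume s * Delta <= ncliques s * volume a * Delta.+1.

(* Replacing the terms of [t] by those of [a] one at a time, each replacement
   multiplies the deficit [k / Delta] by at most [2 * M]: the complement of the
   new term is either too small to matter or a sub-box covered by
   [increment_free]. *)
Lemma increment_free_deficit D Delta M s a t k b :
    0 < M -> M <= D * Delta -> 0 < k -> volume s <= D * ncliques s ->
    increment_free Delta (D * Delta) s ->
    s = b ++ t -> forall b', box M b' b -> box M a t ->
    ncliques s * volume (b' ++ t) * Delta <=
      ncliques (b' ++ t) * volume s * Delta + ncliques s * volume (b' ++ t) * k ->
    ncliques s * volume (b' ++ a) * Delta <=
      ncliques (b' ++ a) * volume s * Delta +
      ncliques s * volume (b' ++ a) * ((2 * M) ^ size t * k).
Proof.
move=> M0 MH + Ds inc.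
elim: t a k b => [|X t IH] [|A a] //= k b k0 sE b' bb; first by rewrite mul1n.
move=> /andP [/andP [AX hX] aat] hk.
rewrite expnSr -[_ ^ _ * _ * k]mulnA -cat_rcons.
have bb' : box M (rcons b' A) (rcons b X).
  by rewrite -!cats1; apply: box_cat => //=; rewrite AX hX.
apply: (IH _ _ (rcons b X)) => //; [lia | by rewrite cat_rcons |].
rewrite cat_rcons.
have := ncliques_split b' t AX.
set B := X :\: A; set rho := volume b' * volume t.
have cX : #|A| + #|B| = #|X| by rewrite /B cardsD (setIidPr AX) subnKC // subset_leq_card.
have vZ Y : volume (b' ++ Y :: t) = #|Y| * rho.
  by rewrite volume_cat volume_cons mulnCA.
have hB : ncliques (b' ++ B :: t) * volume s * Delta <=
    ncliques s * (#|B| * rho) * Delta + ncliques s * (#|X| * rho).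
  have [small|big] := ltnP (D * Delta * #|B|) #|X|.
    have := ncliques_le_volume (b' ++ B :: t); rewrite vZ.
    move: Ds small; move: (ncliques _) (ncliques s) (volume s) => c1 c v.
    move: (#|B|) (#|X|) => nB nX Ds small le.
    apply: leq_trans (leq_addl _ _).
    apply: leq_trans (_ : nB * rho * (D * c) * Delta <= _).
      by rewrite leq_mul2r leq_mul ?orbT.
    by rewrite (_ : _ * Delta = c * (D * Delta * nB * rho)) ?leq_mul ?(ltnW small) //; lia.
  have /inc : box (D * Delta) (b' ++ B :: t) s.
    rewrite sE; apply: box_cat; first exact: box_le bb.
    rewrite /= subsetDl big box_refl // (leq_trans M0 MH) //.
  rewrite vZ mulnS addnC => /leq_trans; apply; rewrite leq_add2l.
  by rewrite !leq_mul // subset_leq_card // subsetDl.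
move: hk; rewrite !vZ => hk cE; move: hk hB; rewrite cE.
move: (ncliques (_ ++ A :: _)) (ncliques (_ ++ B :: _)) (ncliques s) (volume s) => cA cB c v.
move: hX cX; move: (#|A|) (#|B|) (#|X|) => nA nB nX + cX; rewrite -cX => hX hk hB.
have : c * ((nA + nB) * rho) * k.+1 <= c * (nA * rho) * (2 * M * k).
  have -> : c * (nA * rho) * (2 * M * k) = c * (M * nA * rho) * (2 * k) by lia.
  by rewrite !leq_mul //; lia.
move: hk hB; rewrite !mulnDl !mulnDr !mulnDl !mulnS. lia.
Qed.

(** Replacing all terms costs a relative deficit [(2 * M) ^ size s / Delta], which this [Delta]
    makes one half; so [a] keeps at least half the clique density of [s]. *)
Lemma increment_free_regular D M s a :
    let Delta := 2 * (2 * M) ^ size s in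
    0 < M -> 0 < D -> volume s <= D * ncliques s -> 0 < volume s ->
    increment_free Delta (D * Delta) s -> box M a s ->
  volume a <= 2 * D * ncliques a.
Proof.
move=> Delta M0 D0 Ds vs inc bas.
have Dl0 : 0 < Delta by rewrite muln_gt0 expn_gt0 muln_gt0 M0.
have cs : 0 < ncliques s by move: (leq_trans vs Ds); rewrite muln_gt0 => /andP [].
(* For the empty sequence [Delta] is 2 and [M <= D * Delta] may fail; the claim is then direct. *)
case: s => [|X s] in Delta M0 D0 Ds vs inc bas Dl0 cs *.
  by case: a bas => // _; rewrite /volume big_nil /ncliques /= muln1; lia.
have MH : M <= D * Delta.
  rewrite (leq_trans _ (leq_pmull _ D0)) // /Delta /= expnS.
  have := expn_gt0 (2 * M) (size s); rewrite muln_gt0 M0 /= => p0.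
  by rewrite -!mulnA; nia.
have := @increment_free_deficit D Delta M _ a _ 1 [::] M0 MH isT Ds inc erefl [::] isT bas.
rewrite !cat0s muln1 => /(_ (leq_addr _ _)); rewrite {}/Delta in Dl0 inc MH *.
move: ((2 * M) ^ _) => P in Dl0 inc MH *; move: (ncliques a) (volume a) => ca va.
move: (ncliques _) (volume _) => c v in Ds vs cs * => h.
have P0 : 0 < P by lia.
have : c * va <= 2 * ca * v by rewrite -(leq_pmul2r P0); lia.
move=> /leq_trans /(_ (leq_mul (leqnn (2 * ca)) Ds)) {}h.
by rewrite -(leq_pmul2l cs) (leq_trans h) //; lia.
Qed.

(* As long as an increment exists, passing to the corresponding sub-box raises
   the clique density by at least [1 / H]. *)
Lemma increment_free_subbox D Delta T s :
    let H := D * Delta in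
    0 < D -> 0 < Delta -> 0 < volume s -> volume s <= D * ncliques s ->
    volume s * H <= ncliques s * H + volume s * T ->
  exists2 a, box (H ^ T) a s &
    [/\ 0 < volume a, volume a <= D * ncliques a & increment_free Delta H a].
Proof.
move=> H D0 Dl0; have H0 : 0 < H by rewrite muln_gt0 D0.
(* [hT] says that the clique density is at least [1 - T / H]; at [T = 0] it is 1 and cannot grow. *)
elim: T s => [|T IH] s vs Ds hT.
  exists s; rewrite ?box_refl //; split=> // a bas.
  have {hT} : volume s <= ncliques s.
    by move: hT; rewrite muln0 addn0 leq_pmul2r.
  move=> h; rewrite leq_mul //; rewrite mulnC leq_mul ?ncliques_le_volume //.
have [inc|ninc] := boolp.pselect (increment_free Delta H s).
  by exists s => //; rewrite box_refl // expn_gt0 H0.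
have [a bas lt] : exists2 a, box H a s &
    ncliques s * volume a * Delta.+1 < ncliques a * volume s * Delta.
  apply: boolp.contrapT => nex; apply: ninc => a bas; rewrite leqNgt.
  by apply/negP => lt; apply: nex; exists a.
have ca : 0 < ncliques a by case: (ncliques a) lt; rewrite ?mul0n.
have va : 0 < volume a := leq_trans ca (ncliques_le_volume a).
(* The density of [s] is at least [1 / D], so a relative gain above [1 / Delta] is an absolute gain
   above [1 / H]. *)
have [||b bba hb] := IH a va.
- rewrite -(leq_pmul2l vs) -(leq_pmul2r Dl0).
  have : D * (ncliques s * volume a * Delta.+1) <= D * (ncliques a * volume s * Delta).
    by rewrite leq_mul2l (ltnW lt) orbT.
  have : volume s * volume a * Delta <= D * ncliques s * volume a * Delta.
    by rewrite !leq_mul.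
  rewrite mulnS; lia.
- rewrite -(leq_pmul2l vs).
  have h1 : D * (ncliques s * volume a * Delta.+1) <= D * (ncliques a * volume s * Delta).
    by rewrite leq_mul2l (ltnW lt) orbT.
  have h2 : volume s * volume a <= D * ncliques s * volume a by rewrite leq_mul.
  have h3 : volume s * H * volume a <= (ncliques s * H + volume s * T.+1) * volume a.
    by rewrite leq_mul.
  move: h1 h2 h3; rewrite /H mulnS; lia.
by exists b => //; rewrite expnSr; apply: box_trans bba bas.
Qed.

(** The density can grow by at most [1 = H / H], so at most [H] increments occur, each shrinking the
    terms by a factor of at most [H]. The factor [M ^ size s] compares the volume of [t] with that
    of [a]. *)
Lemma regular_subbox D M s :
    let H := D * (2 * (2 * M) ^ size s) in
    0 < M -> 0 < D -> 0 < volume s -> volume s <= D * ncliques s ->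
  exists t, [/\ box (H ^ H) t s, 0 < volume t &
    forall a, box M a t -> volume t <= 2 * D * M ^ size s * ncliques a].
Proof.
move=> H M0 D0 vs Ds.
have Dl0 : 0 < 2 * (2 * M) ^ size s by rewrite muln_gt0 expn_gt0 muln_gt0 M0.
have [t bts [vt Dt inc]] := increment_free_subbox D0 Dl0 vs Ds (leq_addl _ _).
exists t; split=> // a bat.
have szt := box_size bts; rewrite -szt in inc *.
have := increment_free_regular M0 D0 Dt vt inc bat.
move=> /(leq_mul (leqnn (M ^ size t))) /(leq_trans (volume_box bat)) /leq_trans; apply.
by lia.
Qed.

(** * Disjoint families and colourings with sparse classes *)

Definition unions s : {set V} := [set x | has (fun X => x \in X) s].
Arguments unions : simpl never.

Fixpoint disjoint_family s : bool :=
  if s is X :: t then [disjoint X & unions t] && disjoint_family t else true.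

Lemma in_unions_cons x X s : (x \in unions (X :: s)) = (x \in X) || (x \in unions s).
Proof. by rewrite !inE. Qed.

Lemma unions_box k a s : box k a s -> unions a \subset unions s.
Proof.
elim: s a => [|X s IH] [|A a] //= /andP [/andP [/subsetP AX _] /IH /subsetP h].
apply/subsetP => x; rewrite !in_unions_cons => /orP [/AX -> // | /h ->].
by rewrite orbT.
Qed.

Lemma disjoint_family_box k a s : box k a s -> disjoint_family s -> disjoint_family a.
Proof.
elim: s a => [|X s IH] [|A a] //= /andP [/andP [AX _] bas] /andP [dX /(IH _ bas) ->].
by rewrite andbT (disjointWl AX) // (disjointWr (unions_box bas)).
Qed.

Definition degree_sparse m S := forall x, x \in S -> m * #|S :&: nbhd x| <= #|S|.

Definition sparse_subsets m q := forall Y, exists X,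
  [/\ X \subset Y, degree_sparse m X & #|Y| <= q * #|X|].

Definition sparse_colorable m k U := exists2 f : V -> nat,
  {in U, forall x, f x < k} & forall c, degree_sparse m [set x in U | f x == c].

Lemma degree_sparse0 m : degree_sparse m set0.
Proof. by move=> x; rewrite inE. Qed.

Lemma sparse_colorable_set0 m : sparse_colorable m 0 set0.
Proof.
exists (fun _ => 0) => [x|c]; first by rewrite inE.
by rewrite (_ : [set _ in _ | _] = set0); [exact: degree_sparse0 | apply/setP => x; rewrite !inE].
Qed.

Lemma sparse_colorable1 m S : degree_sparse m S -> sparse_colorable m 1 S.
Proof.
move=> spS; exists (fun _ => 0) => // c; case: (eqVneq 0 c) => _.
  by rewrite (_ : [set _ in _ | _] = S) //; apply/setP => x; rewrite !inE andbT.
by rewrite (_ : [set _ in _ | _] = set0); [exact: degree_sparse0 | apply/setP => x; rewrite !inE andbF].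
Qed.

Lemma sparse_colorable_le m k l U : k <= l -> sparse_colorable m k U -> sparse_colorable m l U.
Proof. by move=> kl [f fk spf]; exists f => // x /fk /leq_trans; apply. Qed.

Lemma sparse_colorableU m k l A B : [disjoint A & B] ->
  sparse_colorable m k A -> sparse_colorable m l B -> sparse_colorable m (k + l) (A :|: B).
Proof.
move=> dAB [f fk spf] [g gl spg].
have nB x : x \in A -> x \in B = false by move=> xA; apply: (disjointFr dAB).
exists (fun x => if x \in A then f x else k + g x) => [x|c].
  rewrite inE; case: ifP => [xA _|_ /= xB]; last by rewrite ltn_add2l gl.
  by rewrite (leq_trans (fk _ xA)) ?leq_addr.
have [ck|kc] := ltnP c k.
  suff -> : [set x in A :|: B | (if x \in A then f x else k + g x) == c] =
            [set x in A | f x == c] by [].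
  apply/setP => x; rewrite !inE; case: ifP => //= _; case: (x \in B) => //=.
  by apply/negbTE; rewrite neq_ltn (leq_trans ck) ?orbT ?leq_addr.
suff -> : [set x in A :|: B | (if x \in A then f x else k + g x) == c] =
          [set x in B | g x == c - k] by [].
apply/setP => x; rewrite !inE; case: ifP => /= [xA|_].
  by rewrite nB //; apply/negbTE; rewrite neq_ltn (leq_trans (fk _ xA)).
by case: (x \in B) => //=; rewrite -{1}(subnKC kc) eqn_add2l.
Qed.

(** * Large sparse subsets and peeling *)

(** If [Y] is not sparse, some [v] has more than [#|Y| / m] neighbours in [Y]. Any clique among them
    extends by [v], so [r] drops by one at the cost of a factor [m]. *)
Lemma exists_sparse_subset m r Y : 0 < m -> symmetric e -> irreflexive e ->
    (forall K : {set V}, K \subset Y -> #|K| = r.+1 ->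
       ~ {in K &, forall x y, x != y -> e x y}) ->
  exists X, [/\ X \subset Y, degree_sparse m X & #|Y| <= m ^ r * #|X|].
Proof.
move=> m0 esym eirr; elim: r Y => [|r IH] Y freeY.
  have Y0 : Y = set0.
    apply/eqP; rewrite -subset0; apply/subsetP => y yY.
    case: (freeY [set y]); rewrite ?sub1set ?cards1 // => x z.
    by rewrite !inE => /eqP -> /eqP ->; rewrite eqxx.
  by exists set0; rewrite Y0 cards0; split=> //; apply: degree_sparse0.
have [spY|] := boolP [forall x in Y, m * #|Y :&: nbhd x| <= #|Y|].
  exists Y; split=> //; first by move=> x xY; exact: (forall_inP spY).
  by rewrite leq_pmull ?expn_gt0 ?m0.
move=> /forall_inPn [v vY]; rewrite -ltnNge => degv.
have [K KN cK Kcl|X [XN spX cX]] := IH (Y :&: nbhd v).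
  have vN y : y \in K -> e v y by move=> /(subsetP KN); rewrite !inE => /andP [].
  have vK : v \notin K by apply/negP => /vN; rewrite eirr.
  apply: (freeY (v |: K)); rewrite ?cardsU1 ?vK ?cK //.
    by rewrite subUset sub1set vY (subset_trans KN) ?subsetIl.
  move=> x y; rewrite !inE => /predU1P [->|xK] /predU1P [->|yK]; rewrite ?eqxx // => nxy.
  - exact: vN.
  - by rewrite esym vN.
  - exact: Kcl.
exists X; split=> //; first exact: subset_trans XN (subsetIl _ _).
by rewrite (leq_trans (ltnW degv)) // expnS -mulnA leq_mul2l cX orbT.
Qed.

Lemma exists_subset_card n Y : n <= #|Y| -> exists2 X : {set V}, X \subset Y & #|X| = n.
Proof.
rewrite cardE => nY; exists [set x in take n (enum Y)].
  by apply/subsetP => x; rewrite inE => /mem_take; rewrite mem_enum.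
by rewrite cardsE (card_uniqP _) ?size_takel // take_uniq ?enum_uniq.
Qed.

Lemma expn_bernoulli p n : p ^ n.+1 + n.+1 * p ^ n <= p.+1 ^ n.+1.
Proof.
elim: n => [|n IH]; first by rewrite !expn1 expn0 muln1 addn1.
rewrite [p.+1 ^ _]expnS; apply: leq_trans (leq_mul (leqnn p.+1) IH).
rewrite !expnS; nia.
Qed.

(** Bernoulli's inequality gives [(1 - 1 / q) ^ q <= 1 / 2]: peeling [q] times halves the
    remainder. *)
Lemma double_expn_pred q : 0 < q -> 2 * q.-1 ^ q <= q ^ q.
Proof.
case: q => // p _ /=; apply: leq_trans (expn_bernoulli p p).
by rewrite expnS mulSn; lia.
Qed.

Lemma peel_sparse m q n U : 0 < q ->
    sparse_subsets m q ->
  exists W, [/\ W \subset U, #|W| * q ^ n <= #|U| * q.-1 ^ n &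
    sparse_colorable m n (U :\: W)].
Proof.
move=> q0 exX; elim: n => [|n [W [WU cW colW]]].
  by exists U; rewrite setDv; split=> //; apply: sparse_colorable_set0.
have [X [XW spX cX]] := exX W.
exists (W :\: X); split.
- exact: subset_trans (subsetDl _ _) WU.
- have : #|W :\: X| * q <= #|W| * q.-1.
    rewrite cardsD (setIidPr XW); have := subset_leq_card XW.
    by case: q q0 cX {exX cW} => //= p _; nia.
  move=> h; rewrite !expnS; apply: leq_trans (_ : #|W| * q ^ n * q.-1 <= _).
    by rewrite mulnA [_ * q.-1]mulnAC leq_mul.
  by rewrite [q.-1 * _]mulnC mulnA leq_mul.
rewrite -addn1 (_ : U :\: _ = (U :\: W) :|: X).
  apply: sparse_colorableU => //; last exact: sparse_colorable1.
  apply/pred0P => x /=; rewrite !inE.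
  by apply/negP => /andP [/andP [/negP nW _] /(subsetP XW)].
apply/setP => x; rewrite !inE negb_and negbK andb_orl orbC; congr (_ || _).
case: (boolP (x \in X)) => //= xX.
exact: (subsetP (subset_trans XW WU)).
Qed.

(** Each of [E] blocks of [q] peelings halves the remainder: an exponentially small remainder costs
    only polynomially many colours. *)
Lemma peel_sparse_pow2 m q E U : 0 < q ->
    sparse_subsets m q ->
  exists W, [/\ W \subset U, 2 ^ E * #|W| <= #|U| & sparse_colorable m (q * E) (U :\: W)].
Proof.
move=> q0 exX; have [W [WU cW colW]] := peel_sparse (q * E) U q0 exX.
exists W; split=> //; have : (2 * q.-1 ^ q) ^ E <= (q ^ q) ^ E.
  by case: E {cW colW} => // E; rewrite leq_exp2r // double_expn_pred.
rewrite expnMn -!expnM => h.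
(* The power of [q.-1] to be cancelled can vanish when [q = 1], but then [cW] forces [W] to be
   empty. *)
have [->|U0] := posnP #|W|; first by rewrite muln0.
have pos : 0 < q.-1 ^ (q * E).
  rewrite lt0n; apply/negP => /eqP z; move: cW; rewrite z muln0 leqn0 muln_eq0.
  by rewrite expn_eq0; case: (q) q0 => // p _ /=; rewrite orbF => /eqP c0; rewrite c0 in U0.
rewrite -(leq_pmul2r pos) (leq_trans _ cW) // mulnAC mulnC leq_mul //.
Qed.

(** * Absorbing vertices of the remainder into the sparse sets *)

Definition dense_to m s w := all (fun X => #|X| <= m * #|X :&: nbhd w|) s.

Lemma traces_box m s w : dense_to m s w -> box m (traces w s) s.
Proof. by elim: s => //= X s IH /andP [hX /IH ->]; rewrite subsetIl hX. Qed.

(** Only half of a term may be passed on to the next round; the other half stays to absorb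
    vertices. *)
Definition half_family b s :=
  all2 (fun B X => (B \subset X) && (2 * #|B| <= #|X|)) b s.

(** Degrees are at most [#|X| / k + #|W|], hence at most [2 * #|X| / k], while at least half of [X]
    is present; the ratio is at most [4 / k]. *)
Lemma degree_sparse_absorb m k X B W : 4 * m <= k ->
    degree_sparse k X -> k * #|W| <= #|X| -> B \subset X -> 2 * #|B| <= #|X| ->
  degree_sparse m ((X :\: B) :|: [set w in W | k * #|X :&: nbhd w| < #|X|]).
Proof.
move=> mk spX WX BX hB x; set A := [set w in W | _] => xU.
have AW : #|A| <= #|W| by apply/subset_leq_card/subsetP => y; rewrite inE => /andP [].
have degx : k * #|X :&: nbhd x| <= #|X|.
  move: xU; rewrite !inE => /orP [/andP [_ /spX] // | /andP [_ /ltnW] //].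
have JU : #|X| - #|B| <= #|X :\: B :|: A|.
  by rewrite -(cardsDS BX) subset_leq_card // subsetUl.
have : #|(X :\: B :|: A) :&: nbhd x| <= #|X :&: nbhd x| + #|W|.
  rewrite setIUl (leq_trans (leq_card_setU _ _)) // leq_add //.
    by rewrite subset_leq_card // setSI // subsetDl.
  by rewrite (leq_trans _ AW) // subset_leq_card // subsetIl.
move: JU degx WX mk; move: (#|_ :&: nbhd x|) (#|X :&: nbhd x|) => d dX.
move: (#|_ :|: _|) (#|W|) => u w JU degx WX mk dle.
have : 4 * m * d <= k * (dX + w) by rewrite leq_mul.
by rewrite mulnDr; lia.
Qed.

(** A vertex of [W] joins the last term in which it has few neighbours, so one colour per term
    suffices. *)
Lemma absorb_nondense m k s b W : 4 * m <= k -> disjoint_family (W :: s) ->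
    (forall X, X \in s -> degree_sparse k X /\ k * #|W| <= #|X|) ->
    half_family b s ->
  sparse_colorable m (size s)
    ((unions s :\: unions b) :|: [set w in W | ~~ dense_to k s w]).
Proof.
move=> mk; elim: s b => [|X s IH] [|B b] //=.
  move=> _ _ _; rewrite (_ : _ :|: _ = set0); first exact: sparse_colorable_set0.
  by apply/setP => x; rewrite !inE !andbF.
move=> /andP [dW /andP [dX ds]] spX /andP [/andP [BX hB] hb].
have dWs : [disjoint W & unions s].
  apply: disjointWr dW; apply/subsetP => x; rewrite in_unions_cons => ->.
  by rewrite orbT.
have bs : unions b \subset unions s.
  elim: (s) b hb {IH} => [|Y t IHt] [|A b] //= /andP [/andP [/subsetP AY _] /IHt /subsetP h].
  by apply/subsetP => x; rewrite !in_unions_cons => /orP [/AY -> | /h ->]; rewrite ?orbT.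
have [|Y Ys|f fk spf] := IH b _ _ hb; first by rewrite /= dWs.
  by apply: spX; rewrite inE Ys orbT.
have [spX1 WX] := spX X (mem_head _ _).
have W's : #|[set w in W | dense_to k s w]| <= #|W|.
  by apply/subset_leq_card/subsetP => y; rewrite inE => /andP [].
have kWX : k * #|[set w in W | dense_to k s w]| <= #|X|.
  by rewrite (leq_trans _ WX) // leq_mul2l W's orbT.
have spJ := degree_sparse_absorb mk spX1 kWX BX hB.
have h : sparse_colorable m (size s)
    ((unions s :\: unions b) :|: [set w in W | ~~ dense_to k s w]) by exists f.
have inX x : x \in X -> (x \in W = false) /\ (x \in unions s = false).
  move=> xX; rewrite (disjointFr dX xX) (disjointFl dW) // in_unions_cons xX.
  by split.
have ins x : x \in unions s -> (x \in W = false) /\ (x \in X = false).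
  by move=> xs; rewrite (disjointFl dX xs) (disjointFl dW) // in_unions_cons xs orbT.
have subB x : x \in B -> x \in X by move/(subsetP BX).
have subb x : x \in unions b -> x \in unions s by move/(subsetP bs).
rewrite -add1n.
set U3 := _ :|: _.
have -> : U3 = (X :\: B :|: [set w in [set w in W | dense_to k s w] | k * #|X :&: nbhd w| < #|X|])
  :|: (unions s :\: unions b :|: [set w in W | ~~ dense_to k s w]).
  apply/setP => x; move: (inX x) (ins x) (subB x) (subb x).
  rewrite /U3 !in_setU !in_setD !in_unions_cons.
  move: (x \in unions s) (x \in unions b) => us ub.
  rewrite !in_set /= negb_and -ltnNge.
  case: (x \in X) => [/(_ isT) [-> ->] _ _|_].
    by case: ub => [/(_ isT)|] //; rewrite !(andbF, orbF, andbT, orbT).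
  case: (x \in B) => [_ /(_ isT)|] //.
  case: us => [/(_ isT) [-> _] _ _|_ _]; first by rewrite !(andbF, orbF, andbT, orbT).
  case: ub => [/(_ isT)|_] //=.
  by case: (x \in W) => //=; case: (dense_to k s x); rewrite ?orbT ?orbF ?andbT.
apply: sparse_colorableU h; last exact: sparse_colorable1.
apply/pred0P => x /=; move: (inX x) (ins x).
rewrite !in_setU !in_setD; move: (x \in unions s) (x \in unions b) => us ub.
rewrite !in_set; case: (x \in X) => [/(_ isT) [-> ->] _|_] /=; first by rewrite !(andbF, orbF).
case: us => [/(_ isT) [-> _]|_] /=; rewrite ?(andbF, orbF) //=.
by case: (x \in W) => //=; case: (dense_to k s x); rewrite ?(andbF, orbF).
Qed.

(** * One round: lengthening the regular family *)

Lemma exists_sparse_half k q X Y : 1 < #|X| -> Y \subset X ->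
    sparse_subsets k q ->
  exists Z, [/\ Z \subset Y, degree_sparse k Z, #|Y| <= 3 * q * #|Z| & 2 * #|Z| <= #|X|].
Proof.
move=> X2 YX exZ; have YleX := subset_leq_card YX.
(* Halving with rounding down loses a factor of at most 3 once [#|Y| >= 2]; a single vertex is at
   most half of [X] because [#|X| > 1]. *)
have [n nY [Yn nX]] : exists2 n, n <= #|Y| & #|Y| <= 3 * n /\ 2 * n <= #|X|.
  have [Y1|Y1] := leqP #|Y| 1; first by exists #|Y| => //; lia.
  by exists #|Y|./2; lia.
have [Z ZY cZ] := exists_subset_card nY.
have [T [TZ spT cT]] := exZ Z; exists T; split=> //.
- exact: subset_trans TZ ZY.
- by rewrite (leq_trans Yn) // -cZ -mulnA leq_mul2l cT.
- by rewrite (leq_trans _ nX) // leq_mul2l -cZ subset_leq_card.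
Qed.

Lemma exists_sparse_half_family k q l s t :
    all (fun X => 1 < #|X|) s -> box l t s ->
    sparse_subsets k q ->
  exists b, [/\ box (3 * q) b t, half_family b s & forall X, X \in b -> degree_sparse k X].
Proof.
move=> + + exZ; elim: s t => [|X s IH] [|Y t] //=; first by exists [::].
move=> /andP [X2 s2] /andP [/andP [YX _] bts].
have [b [bb hb spb]] := IH t s2 bts.
have [Z [ZY spZ cZ hZ]] := exists_sparse_half X2 YX exZ.
exists (Z :: b); split=> /=; rewrite ?ZY ?cZ ?bb //.
  by rewrite (subset_trans ZY YX) hZ.
by move=> A; rewrite inE => /predU1P [->|/spb].
Qed.

(** The traces of each [w] in [W] form a box in [s], so [W :: s] has clique density at least [1 / D]
    and a regular sub-box. Its terms are then made sparse, losing a factor [3 * q]; regularity at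
    scale [M = k * (3 * q)] survives this at scale [k]. *)
Lemma next_level k q D s W :
    let M := k * (3 * q) in
    let n := (size s).+1 in
    let H := D * (2 * (2 * M) ^ n) in
    1 < k -> 0 < q -> 0 < D -> 0 < #|W| -> sparse_subsets k q ->
    (forall X, X \in s -> k * #|W| <= #|X|) ->
    {in W, forall w, dense_to k s w} ->
    (forall a, box k a s -> volume s <= D * ncliques a) ->
  exists B b, [/\ box (3 * q * H ^ H) (B :: b) (W :: s), half_family b s,
    forall X, X \in B :: b -> degree_sparse k X &
    forall a, box k a (B :: b) -> volume (B :: b) <= 2 * D * M ^ n * ncliques a].
Proof.
move=> M n H k1 q0 D0 W0 exq sW Wdense reg.
have k0 : 0 < k := ltnW k1.
have M0 : 0 < M by rewrite !muln_gt0 k0 q0.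
have s1 : all (fun X => 1 < #|X|) s.
  apply/allP => X /sW; apply: leq_trans.
  by rewrite (leq_trans k1) // leq_pmulr.
have vs : 0 < volume s.
  by rewrite /volume big_seq prodn_cond_gt0 // => X /(allP s1) /ltnW.
have vWs : 0 < volume (W :: s) by rewrite volume_cons muln_gt0 W0.
have Ds : volume (W :: s) <= D * ncliques (W :: s).
  rewrite ncliques_cons volume_cons -sum_nat_const big_distrr /=.
  by apply: leq_sum => w wW; apply/reg/traces_box/Wdense.
have [t [btW vt regt]] := regular_subbox M0 D0 vWs Ds.
case: t => [|Y t] // in btW vt regt *.
(* The first term lies in [W], whose other vertices are peeled off later and absorb nothing, so no
   bound by half is imposed. *)
have [B [BY spB cB]] := exq Y.
have bts : box (H ^ H) t s by move: btW => /= /andP [].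
have [b [bbt hbs spb]] := exists_sparse_half_family s1 bts exq.
have bBb : box (3 * q) (B :: b) (Y :: t).
  by rewrite /= BY bbt (leq_trans cB) // leq_mul2r leq_pmull ?orbT.
exists B, b; split=> //; first exact: box_trans bBb btW.
  by move=> X; rewrite inE => /predU1P [->|/spb].
move=> a ba; apply: leq_trans (volume_box_le bBb) (regt a _).
exact: box_trans ba bBb.
Qed.

(* [W] is the remainder and [s] the current regular family of sparse sets. *)
Definition level k D W s := [/\ disjoint_family (W :: s),
  forall X, X \in s -> degree_sparse k X /\ k * #|W| <= #|X| &
  forall a, box k a s -> volume s <= D * ncliques a].

(** Vertices dense to [s] supply the new term and are otherwise peeled down to [W']; the remaining
    ones are absorbed by what [s] leaves behind. The condition on [E] makes [W'] tiny against the
    new terms. *)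
Lemma level_step m k q D E W s :
    let M := k * (3 * q) in
    let n := (size s).+1 in
    let H := D * (2 * (2 * M) ^ n) in
    0 < m -> 4 * m <= k -> 0 < q -> 0 < D -> k * (3 * q * H ^ H) <= 2 ^ E ->
    sparse_subsets k q -> level k D W s -> [set w in W | dense_to k s w] != set0 ->
  exists W' s', [/\ size s' = n, level k (2 * D * M ^ n) W' s',
    W' :|: unions s' \subset W :|: unions s &
    sparse_colorable m (size s + q * E) ((W :|: unions s) :\: (W' :|: unions s'))].
Proof.
move=> M n H m0 mk q0 D0 hE exq [dWs spW reg]; set W0 := [set w in W | _].
rewrite -card_gt0 => W00.
have k1 : 1 < k by lia.
have W0W : W0 \subset W by apply/subsetP => w; rewrite inE => /andP [].
have W0s X : X \in s -> k * #|W0| <= #|X|.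
  by move=> /spW [_]; apply: leq_trans; rewrite leq_mul2l subset_leq_card ?orbT.
have W0d : {in W0, forall w, dense_to k s w} by move=> w; rewrite inE => /andP [].
have [B [b [bBb hbs spB regB]]] := next_level k1 q0 D0 W00 exq W0s W0d reg.
have exqm : sparse_subsets m q.
  move=> Y; have [X [XY spX cX]] := exq Y; exists X; split=> // x /spX.
  by apply: leq_trans; rewrite leq_mul2r; apply/orP; right; lia.
have [W1 [W1U cW1 colW1]] := peel_sparse_pow2 E (W0 :\: B) q0 exqm.
have BW0 : B \subset W0 by move: bBb => /= /andP [/andP []].
have bbs : unions b \subset unions s.
  by move: bBb => /= /andP [_ /unions_box].
have /= /andP [dW ds] := dWs.
have dW0s : disjoint_family (W0 :: s) by rewrite /= (disjointWl W0W) // ds.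
have dBb := disjoint_family_box bBb dW0s.
have W1W0 : W1 \subset W0 := subset_trans W1U (subsetDl _ _).
have W1B x : x \in W1 -> x \in B = false.
  by move/(subsetP W1U); rewrite inE => /andP [/negbTE].
exists W1, (B :: b); split.
- exact: box_size bBb.
- split=> //.
    rewrite /= -/(disjoint_family (B :: b)) dBb andbT.
    apply/pred0P => x /=; apply/negP => /andP [xW1]; rewrite in_unions_cons W1B //=.
    move/(subsetP bbs); rewrite (disjointFr dW) //.
    exact: (subsetP (subset_trans W1W0 W0W)).
  move=> X XB; split; first exact: spB.
  (* No term of [W0 :: s] is smaller than [W0], so the box bounds every new term below in terms of
     [#|W0|]. *)
  have : #|W0| <= 3 * q * H ^ H * #|X|.
    have W0Ws Y : Y \in W0 :: s -> #|W0| <= #|Y|.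
      rewrite inE => /predU1P [-> //|/W0s]; apply: leq_trans.
      by rewrite leq_pmull // ltnW.
    elim: (B :: b) (W0 :: s) bBb XB W0Ws {spB regB dBb dW0s} => [|A a IH] [|Y t] //=.
    move=> /andP [/andP [_ hA] ba] XA Yt; move: XA; rewrite inE => /predU1P [->|Xa].
      by rewrite (leq_trans _ hA) // Yt ?mem_head.
    by apply: IH ba Xa _ => Z Zt; apply: Yt; rewrite inE Zt orbT.
  move: hE cW1; have /subset_leq_card : W0 :\: B \subset W0 := subsetDl _ _.
  have : 0 < 3 * q * H ^ H by rewrite !muln_gt0 q0 expn_gt0 !muln_gt0 D0 expn_gt0 !muln_gt0 q0 (ltnW k1).
  move: (3 * q * H ^ H) (2 ^ E) => L P L0 h1 hE h2 h3.
  rewrite -(leq_pmul2l L0) (leq_trans _ h3) // (leq_trans _ h1) // (leq_trans _ h2) //.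
  by rewrite mulnCA mulnA leq_mul2r hE orbT.
- apply/subsetP => x; rewrite !in_setU in_unions_cons.
  move=> /or3P [/(subsetP W1W0)/(subsetP W0W) -> //|/(subsetP BW0)/(subsetP W0W) -> //|].
  by move/(subsetP bbs) ->; rewrite orbT.
set U := _ :\: _.
have -> : U = ((unions s :\: unions b) :|: [set w in W | ~~ dense_to k s w])
              :|: ((W0 :\: B) :\: W1).
  apply/setP => x; rewrite /U.
  have := subsetP W1W0 x; have := subsetP BW0 x; have := subsetP bbs x.
  have := @W1B x; have := disjointFr dW (x := x).
  rewrite !in_setD !in_setU !in_setD in_unions_cons.
  move: (x \in unions s) (x \in unions b) (x \in W1) (x \in B) => us ub w1 xb.
  rewrite !in_set; case: (x \in W) => /= [/(_ isT) ->|_].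
    by case: (dense_to k s x); case: ub; case: w1; case: xb => /= h1 h2 h3 h4;
      first [done | by have := h1 isT | by have := h2 isT | by have := h3 isT
            | by have := h4 isT].
  by case: us; case: ub; case: w1; case: xb => /= h1 h2 h3 h4;
      first [done | by have := h1 isT | by have := h2 isT | by have := h3 isT
            | by have := h4 isT].
apply: sparse_colorableU colW1; last exact: absorb_nondense.
apply/pred0P => x /=; have := disjointFr dW (x := x).
rewrite !in_setU !in_setD; move: (x \in unions s) (x \in unions b) => us ub.
rewrite !in_set; case: (x \in W) => /= [/(_ isT) ->|_]; last by rewrite !andbF.
by rewrite andbF /=; case: (dense_to k s x) => //=; rewrite !andbF.
Qed.

Lemma level_le k D D' W s : D <= D' -> level k D W s -> level k D' W s.
Proof.
move=> DD' [dW spW reg]; split=> // a /reg /leq_trans; apply.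
by rewrite leq_mul2r DD' orbT.
Qed.

(** Nothing has to be passed on: empty sets serve as the half family, and [s] absorbs all of [W]. *)
Lemma level_colorable_nondense m k D W s : 0 < m -> 4 * m <= k ->
    level k D W s -> [set w in W | dense_to k s w] = set0 ->
  sparse_colorable m (size s) (W :|: unions s).
Proof.
move=> m0 mk [dW spW reg] W0.
have h : half_family [seq set0 | _ <- s] s.
  by elim: (s) => //= X t ->; rewrite sub0set cards0.
have -> : W :|: unions s = (unions s :\: unions [seq set0 | _ <- s])
            :|: [set w in W | ~~ dense_to k s w].
  have u0 : unions [seq set0 | _ <- s] = set0.
    apply/setP => x; rewrite !inE; elim: (s) => //= X t ->; by rewrite inE.
  apply/setP => x; rewrite u0 !in_setU in_setD !in_set orbC; congr (_ || _).
  move/setP: W0 => /(_ x); rewrite !inE; case: (x \in W) => //= ->.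
  by [].
exact: absorb_nondense.
Qed.

(** The traces of a dense [w] form a box in [s], so by regularity they contain a transversal clique,
    which [w] extends. *)
Lemma level_dense_clique k D W s : symmetric e -> irreflexive e -> 0 < k ->
    level k D W s -> [set w in W | dense_to k s w] != set0 ->
  exists2 K : {set V}, #|K| = (size s).+1 & {in K &, forall x y, x != y -> e x y}.
Proof.
move=> esym eirr k0 [_ spW reg] /set0Pn [w]; rewrite inE => /andP [wW dw].
have W0 : 0 < #|W| by apply/card_gt0P; exists w.
have vs : 0 < volume s.
  rewrite /volume big_seq prodn_cond_gt0 // => X /spW [_]; apply: leq_trans.
  by rewrite muln_gt0 k0.
have : 0 < ncliques ([set w] :: s).
  rewrite ncliques_cons big_set1.
  by have := leq_trans vs (reg _ (traces_box dw)); rewrite muln_gt0 => /andP [].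
by move=> /(ncliques_gt0_clique esym eirr) [K cK [Kcl _]]; exists K.
Qed.

End TransversalCliques.

(** * Iterating the rounds with polynomial bounds *)

Lemma leq_expn_self m C : 1 < m -> C <= m ^ C.
Proof. by move=> m1; apply/ltnW/ltn_expl. Qed.

(** Induction on the number [j] of rounds left; at [j = 0] a dense vertex would yield a clique on
    [r.+1] vertices. Each round raises the exponent [d], which is therefore general in the
    induction, and [C] depends only on [r], [j] and [d]. *)
Lemma level_colorable r j d : exists C, forall m (V : finType) (e : rel V),
    1 < m -> symmetric e -> irreflexive e ->
    (forall K : {set V}, #|K| = r.+1 -> ~ {in K &, forall x y, x != y -> e x y}) ->
    forall (W : {set V}) s, size s = r - j ->
    level e (m ^ 3) (m ^ d) W s ->
  sparse_colorable e m (m ^ C) (W :|: unions s).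
Proof.
elim: j d => [|j IH] d.
  exists r => m V e m1 esym eirr free W s; rewrite subn0 => sz lev.
  have m0 := ltnW m1.
  have mk : 4 * m <= m ^ 3 by rewrite !expnS expn0; nia.
  have [W0|W0] := eqVneq [set w in W | dense_to e (m ^ 3) s w] set0.
    apply: sparse_colorable_le (level_colorable_nondense m0 mk lev W0).
    by rewrite sz leq_expn_self.
  have [|K cK Kcl] := level_dense_clique esym eirr _ lev W0; first by rewrite expn_gt0 m0.
  by case: (free K) => //; rewrite cK sz.
(* Truncated subtraction: for [r <= j] both [r - j] and [r - j.+1] are 0. *)
have [rj|jr] := leqP r j.
  have [C hC] := IH d; exists C => m V e m1 esym eirr free W s sz.
  by apply: hC => //; rewrite sz; lia.
(* Exponents with [M <= m ^ a] and [H <= m ^ h], using [3 <= m ^ 2] and [2 <= m]. *)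
pose n := r - j; pose a := 3 * r + 5; pose h := d + 1 + n * a.+1.
have [C hC] := IH (d + 1 + n * a).
(* [m ^ c] bounds each of the four colour counts [size s], [q * M], [q * (H * H)] and [m ^ C]; their
   sum fits in [m ^ (3 + c)]. *)
pose c := r + (3 * r + a + 2 * h) + C.
have [c1 c2 c3 c4] : [/\ r <= c, 3 * r + a <= c, 3 * r + (h + h) <= c & C <= c].
  by rewrite /c; split; lia.
exists (3 + c) => m V e m1 esym eirr free W s sz lev.
have m0 := ltnW m1.
have mk : 4 * m <= m ^ 3 by rewrite !expnS expn0; nia.
have [W0|W0] := eqVneq [set w in W | dense_to e (m ^ 3) s w] set0.
  apply: sparse_colorable_le (level_colorable_nondense m0 mk lev W0).
  by rewrite sz (leq_trans _ (leq_expn_self _ m1)) // (leq_trans (leq_subr _ _)) ?(leq_trans c1) ?leq_addl.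
have nE : (size s).+1 = n by rewrite sz /n subnSK.
pose q := (m ^ 3) ^ r; pose M := m ^ 3 * (3 * q).
pose H := m ^ d * (2 * (2 * M) ^ n).
have exq : sparse_subsets e (m ^ 3) q.
  by move=> Y; apply: exists_sparse_subset => //; rewrite ?expn_gt0 ?m0 // => K _; apply: free.
have qE : q = m ^ (3 * r) by rewrite /q -expnM.
have Ma : M <= m ^ a.
  rewrite /M qE /a (_ : 3 * r + 5 = 3 + (2 + 3 * r)) ?expnD ?leq_mul2l ?leq_mul2r //; last by lia.
  by rewrite (_ : 3 <= m ^ 2) ?orbT //; nia.
have n0 : 0 < n by rewrite -nE.
have Hh : H <= m ^ h.
  rewrite /H /h !expnD -mulnA leq_mul2l expn1 leq_mul ?orbT //.
  by rewrite [n * _]mulnC expnM leq_exp2r // expnS leq_mul.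
have D' : 2 * m ^ d * M ^ n <= m ^ (d + 1 + n * a).
  rewrite !expnD expn1 [m ^ d * m]mulnC leq_mul ?leq_mul2r ?m1 ?orbT //.
  by rewrite [n * _]mulnC expnM leq_exp2r.
(* The exponent [M + H * H] is polynomial in [m] and suffices since [M <= 2 ^ M] and
   [H ^ H <= (2 ^ H) ^ H]. *)
have hE : let H' := m ^ d * (2 * (2 * M) ^ (size s).+1) in
    m ^ 3 * (3 * q * H' ^ H') <= 2 ^ (M + H * H).
  rewrite nE -/H; cbv zeta; rewrite mulnA expnD expnM leq_mul //; first exact: leq_expn_self.
  have H0 : 0 < H by rewrite !muln_gt0 !expn_gt0 !muln_gt0 !expn_gt0 m0.
  by rewrite leq_exp2r //; exact: leq_expn_self.
have q0 : 0 < q by rewrite qE expn_gt0 m0.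
have D0 : 0 < m ^ d by rewrite expn_gt0 m0.
have [W' [s' [sz' lev' sub col]]] := level_step m0 mk q0 D0 hE exq lev W0.
rewrite nE in sz' lev'.
have := hC m V e m1 esym eirr free W' s' sz' (level_le D' lev').
have dis : [disjoint (W :|: unions s) :\: (W' :|: unions s') & W' :|: unions s'].
  by apply/pred0P => x /=; rewrite in_setD; case: (_ \in _ :|: _); rewrite ?andbF.
move=> /(sparse_colorableU dis col); rewrite (_ : _ :|: _ = W :|: unions s); last first.
  by rewrite setUC -{1}(setIidPr sub) setID.
apply: sparse_colorable_le.
have le_exp i : i <= c -> m ^ i <= m ^ c by rewrite leq_exp2l.
have h1 : size s <= m ^ c.
  by rewrite sz (leq_trans (leq_subr _ _)) // (leq_trans (leq_expn_self r m1)) ?le_exp.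
have h2 : q * M <= m ^ c.
  by rewrite (leq_trans (leq_mul (leqnn q) Ma)) // qE -expnD le_exp.
have h3 : q * (H * H) <= m ^ c.
  by rewrite (leq_trans (leq_mul (leqnn q) (leq_mul Hh Hh))) // qE -!expnD le_exp.
have h4 : 4 * m ^ c <= m ^ (3 + c).
  by rewrite expnD leq_mul2r (leq_trans _ mk) ?orbT // leq_pmulr.
apply: leq_trans h4; rewrite mulnDr addnA.
rewrite (_ : 4 * m ^ c = m ^ c + m ^ c + m ^ c + m ^ c); last by rewrite !mulSn addn0 !addnA.
by rewrite !leq_add // le_exp.
Qed.

(** * From colourings to partitions and real [eps] *)

Lemma sparse_colorable_partition (V : finType) (e : rel V) m k :
    sparse_colorable e m k [set: V] ->
  exists P : {set {set V}}, [/\ partition P [set: V], #|P| <= k &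
    forall S, S \in P -> degree_sparse e m S].
Proof.
move=> [f fk spf]; exists (preim_partition f [set: V]).
pose fiber c : {set V} := [set y | c == f y].
have fiberE x : [set y in [set: V] | f x == f y] = fiber (f x).
  by apply/setP => y; rewrite !inE.
split; first exact: preim_partitionP.
  (* Every block is one of the fibres of [f] over ['I_k]. *)
  rewrite -[k in _ <= k]card_ord -cardsT.
  apply: leq_trans (leq_imset_card (fun i : 'I_k => fiber i) _).
  apply/subset_leq_card/subsetP => S /imsetP [x _ ->].
  by apply/imsetP; exists (Ordinal (fk x (in_setT x))); rewrite ?inE ?fiberE.
move=> S /imsetP [x _ ->]; rewrite fiberE.
rewrite (_ : fiber _ = [set y in [set: V] | f y == f x]); first exact: spf.
by apply/setP => y; rewrite !inE eq_sym.
Qed.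

From mathcomp Require Import all_boot all_order all_algebra.
From mathcomp Require Import all_classical all_reals all_analysis.

Import Order.TTheory GRing.Theory Num.Theory.
Local Open Scope ring_scope.

Lemma degree_sparse_sparse (R : realType) (eps : R) (V : finType) (e : rel V)
    (m : nat) (S : {set V}) :
  (0 < m)%N -> 1 / eps <= m%:R -> 0 < eps -> degree_sparse e m S -> sparse eps e S.
Proof.
move=> m0 epsm eps0 spS.
have -> : sparse eps e S = ((induced_max_degree e S)%:R <= eps * #|S|%:R) by [].
have deg : (m * induced_max_degree e S <= #|S|)%N.
  rewrite mulnC -leq_divRL //; apply/bigmax_leqP => x xS.
  rewrite leq_divRL // mulnC; apply: leq_trans (spS x xS).
  rewrite leq_mul2l; apply/orP; right.
  by apply/subset_leq_card/fintype.subsetP => y; rewrite !inE.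
rewrite -ler_pdivrMl // -div1r (le_trans (ler_wpM2r _ epsm)) ?ler0n //.
by rewrite -natrM ler_nat.
Qed.

Theorem theorem8 (R : realType) (r : nat) (hr : (2 <= r)%N) :
  exists C : R, 0 < C /\
    forall eps : R, 0 < eps -> eps <= 1 / 2 ->
    forall (V : finType) (e : rel V),
      symmetric e -> irreflexive e -> complete_free e r.+1 ->
      exists P : {set {set V}},
        [/\ finset.partition P [set: V]%SET,
            #|P|%:R <= (1 / eps) `^ C
          & forall S : {set V}, S \in P -> sparse eps e S].
Proof.
have [C hC] := level_colorable r r 0.
(* The factor 2 comes from [m <= (1 / eps) ^ 2]; the successor keeps the constant positive when
   [C = 0]. *)
exists ((2 * C).+1)%:R; split=> [|eps eps0 eps2 V e esym eirr free]; first by rewrite ltr0n.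
have inv2 : 2 <= 1 / eps by rewrite ler_pdivlMr // mulrC -ler_pdivlMr.
pose m := (Num.truncn (1 / eps)).+1.
have inv0 : 0 <= 1 / eps by rewrite (le_trans _ inv2).
have epsm : 1 / eps <= m%:R by rewrite ltW // truncnS_gt.
have m1 : (1 < m)%N by rewrite -(ltr_nat R) (lt_le_trans _ epsm) // (lt_le_trans _ inv2) // ltr1n.
(* Since [1 / eps >= 2], [m <= 1 / eps + 1 <= 2 * (1 / eps) <= (1 / eps) ^ 2]. *)
have mle : m%:R <= (1 / eps) ^+ 2.
  rewrite -natr1 (le_trans (_ : _ <= 1 / eps + 1)) ?lerD2r ?truncn_le //.
  rewrite expr2 (le_trans (_ : _ <= 2 * (1 / eps))) ?ler_wpM2r //.
  by rewrite mulr_natl mulr2n lerD2l (le_trans _ inv2) // ler1n.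
(* The rounds start with every vertex in the remainder; the empty family has volume 1 and one empty
   clique. *)
have lev : level e (m ^ 3) (m ^ 0) [set: V]%SET [::].
  split=> //=; first by rewrite andbT; apply/pred0P => x /=; rewrite !inE andbF.
  by case=> // _; rewrite /volume big_nil.
have freeK (K : {set V}) : #|K| = r.+1 -> ~ {in K &, forall x y, x != y -> e x y}.
  by move=> cK Kcl; apply: free; exists K.
have szE : size ([::] : seq {set V}) = (r - r)%N by rewrite subnn.
have := hC m V e m1 esym eirr freeK _ _ szE lev.
rewrite (_ : _ :|: _ = [set: V]%SET); last by apply/setP => x; rewrite !inE.
move=> /sparse_colorable_partition [P [partP cP spP]]; exists P; split=> // [|S SP].
  rewrite powR_mulrn //; apply: (@le_trans _ _ (m%:R ^+ C)); first by rewrite -natrX ler_nat.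
  apply: (@le_trans _ _ ((1 / eps) ^+ (2 * C))).
    by rewrite exprM lerXn2r ?nnegrE ?exprn_ge0.
  by rewrite exprS ler_peMl ?exprn_ge0 // (le_trans _ inv2) // ler1n.
by apply: degree_sparse_sparse (spP S SP) => //; apply: ltnW.
Qed.
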